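(* Let $a<b$, $g(u)=(b-u)(u-a)$, so $g'(u)=a+b-2u$. Let $T>0$, $\delta t>0$, and let the spatial discretization ($\Sigma_h$, $X_h$, $(\cdot,\cdot)_h$, $\|\cdot\|$, $\langle\mathcal L_h\cdot,\cdot\rangle$) be as described in the context. Assume: (i) $\mathcal N(u)=f_1(u)+\nabla\cdot f_2(u)$ where $f_1,f_2$ are locally Lipschitz functions of $u$ with $f_1(0)=f_2(0)=0$; (ii) there are constants $C_1,C_2$ with $|f_1(u)|\le C_1|u|$ and $|f_2(u)|\le C_2|u|$ for all $a\le u\le b$; (iii) there is $C_0>0$ (independent of $h$) such that $C_0\|\nabla u_h\|^2\le\langle\mathcal L_hu_h,u_h\rangle$ for all $u_h\in X_h$. Let $u_h^0\in X_h$ satisfy $a\le u_h^0(\boldsymbol z)\le b$ for all $\boldsymbol z\in\Sigma_h$. Set $w_h^0=u_h^0$ and $w_h^n=2u_h^n-u_h^{n-1}$ for $n\ge1$. Suppose $\tilde u_h^{n+1},u_h^{n+1}\in X_h$, $\lambda_h^{n+1}:\Sigma_h\to\mathbb R$, $\xi_h^{n+1}\in\mathbb R$ ($n\ge 0$) are generated as follows. For $n\ge1$ (second-order bound and mass preserving scheme): Step 1: for all $v_h\in X_h$, $$\Big(\frac{3\tilde u_h^{n+1}-4u_h^n+u_h^{n-1}}{2\delta t},v_h\Big)_h+\langle\mathcal L_h\tilde u_h^{n+1},v_h\rangle+(f_1(w_h^n),v_h)_h-(f_2(w_h^n),\nabla v_h)_h=(\lambda_h^ng'(u_h^n)+\xi_h^n,v_h)_h;$$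 Step 2: for all $\boldsymbol z\in\Sigma_h$, $$\frac{3(u_h^{n+1}(\boldsymbol z)-\tilde u_h^{n+1}(\boldsymbol z))}{2\delta t}=\lambda_h^{n+1}(\boldsymbol z)g'(u_h^{n+1}(\boldsymbol z))-\lambda_h^n(\boldsymbol z)g'(u_h^n(\boldsymbol z))+\xi_h^{n+1}-\xi_h^n,$$ $$\lambda_h^{n+1}(\boldsymbol z)\ge0,\quad g(u_h^{n+1}(\boldsymbol z))\ge0,\quad\lambda_h^{n+1}(\boldsymbol z)g(u_h^{n+1}(\boldsymbol z))=0,$$ and $(u_h^{n+1},1)_h=(u_h^n,1)_h$. For $n=0$ (first-order start): for all $v_h\in X_h$, $$\Big(\frac{\tilde u_h^1-u_h^0}{\delta t},v_h\Big)_h+\langle\mathcal L_h\tilde u_h^1,v_h\rangle+(f_1(w_h^0),v_h)_h-(f_2(w_h^0),\nabla v_h)_h=0,$$ and for all $\boldsymbol z\in\Sigma_h$, $$\frac{u_h^1(\boldsymbol z)-\tilde u_h^1(\boldsymbol z)}{\delta t}=\lambda_h^1(\boldsymbol z)g'(u_h^1(\boldsymbol z))+\xi_h^1,\quad\lambda_h^1(\boldsymbol z)\ge0,\quad g(u_h^1(\boldsymbol z))\ge0,\quad\lambda_h^1(\boldsymbol z)g(u_h^1(\boldsymbol z))=0,$$ and $(u_h^1,1)_h=(u_h^0,1)_h$. Assume moreover that the generic scheme is mass conservative, i.e. for all $n\ge0$, $$\langle\mathcal L_h\tilde u_h^{n+1},1\rangle+(f_1(w_h^n),1)_h-(f_2(w_h^n),\nabla1)_h=0.$$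 Then there is a constant $C(T)>0$, independent of $\delta t$ and $h$, such that for all integers $m$ with $1\le m\le T/\delta t$, $$4\|u_h^m\|^2+\|2u_h^m-u_h^{m-1}\|^2+\frac43\delta t^2\|\lambda_h^mg'(u_h^m)+\xi_h^m\|^2+2\delta t\sum_{n=0}^{m-1}C_0\|\nabla\tilde u_h^{n+1}\|^2\le C(T)\|u_h^0\|^2.$$
   Context: The underlying PDE is $u_t+\mathcal Lu+\mathcal N(u)=0$ on a bounded domain $\Omega\subset\mathbb R^d$, with $\mathcal L$ a second-order unbounded positive self-adjoint operator in $L^2(\Omega)$, $f_1$ scalar valued and $f_2$ $\mathbb R^d$-valued. The PDE solution is assumed to stay in $[a,b]$ when its initial value does. $\Sigma_h$ is a finite set of mesh (collocation) points in $\bar\Omega$. $X_h$ is a finite-dimensional space of functions with a Lagrangian (nodal) basis on $\Sigma_h$, so that its elements are identified with their values on $\Sigma_h$. The constant function $1$ is an admissible test function in $X_h$. The discrete inner product is $(u,v)_h=\sum_{\boldsymbol z\in\Sigma_h}\beta_{\boldsymbol z}u(\boldsymbol z)v(\boldsymbol z)$ with weights $\beta_{\boldsymbol z}>0$ (for vector fields, the product $u(\boldsymbol z)v(\boldsymbol z)$ is the Euclidean dot product), and $\|u\|=(u,u)_h^{1/2}$; this norm is assumed equivalent to the $L^2$ norm on $X_h$. $\langle\mathcal L_hu_h,v_h\rangle$ denotes the bilinear form on $X_h\times X_h$ approximating $\mathcal L$, obtained from the discrete inner product after suitable integration by parts. Superscripts $n$ refer to time $t^n=n\,\delta t$. The constant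 $C(T)$ may depend on $T$ and on the fixed data $a,b,f_1,f_2,C_0,C_1,C_2$, but not on $\delta t$ or on the spatial discretization. *)

(* Defs.v *)
From HB Require Import structures.
From mathcomp Require Import all_boot all_order all_algebra.
From mathcomp Require Import all_classical all_reals all_analysis.

Set Implicit Arguments.
Unset Strict Implicit.
Unset Printing Implicit Defensive.

Import Order.TTheory GRing.Theory Num.Theory.
Import numFieldNormedType.Exports.

Local Open Scope classical_set_scope.
Local Open Scope ring_scope.

Section Euclidean.
Variables (R : realType) (d : nat).

(* The library norm on 'rV[R]_d is the sup norm, so the Euclidean structure is
   spelled out. *)
Definition edot (p q : 'rV[R]_d) : R := \sum_(k < d) p ord0 k * q ord0 k.

Definition enorm (p : 'rV[R]_d) : R := Num.sqrt (edot p p).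

(* [p] is a gradient at [z] of the restriction of [u] to [A]; at an interior
   point of [A] this is the ordinary gradient. *)
Definition has_gradient (A : set 'rV[R]_d) (u : 'rV[R]_d -> R)
    (z p : 'rV[R]_d) : Prop :=
  forall e : R, 0 < e ->
    \forall y \near within A (nbhs z),
      `|u y - u z - edot p (y - z)| <= e * enorm (y - z).

End Euclidean.

Section L2.
Variable R : realType.

(* The library has no Lebesgue measure on 'rV[R]_d. For a nonnegative Borel
   function the iterated integral below is, by Tonelli, its integral with
   respect to the d-dimensional Lebesgue measure. *)
Fixpoint iterated_integral (d : nat) : ('rV[R]_d -> \bar R) -> \bar R :=
  match d return ('rV[R]_d -> \bar R) -> \bar R with
  | 0 => fun f => f 0
  | d'.+1 => fun f =>
      (\int[lebesgue_measure]_(x in [set: R])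
        @iterated_integral d'
          (fun y => f (row_mx (const_mx x : 'rV[R]_1) y)))%E
  end.

Definition l2sq (d : nat) (A : set 'rV[R]_d) (u : 'rV[R]_d -> R) : \bar R :=
  iterated_integral (fun x => (u x ^+ 2 * \1_A x)%:E).

Definition l2norm (d : nat) (A : set 'rV[R]_d) (u : 'rV[R]_d -> R) : R :=
  Num.sqrt (fine (l2sq A u)).

Definition borel_fun (d : nat) (A : set 'rV[R]_d) (u : 'rV[R]_d -> R) : Prop :=
  @measurable_fun _ _ (g_sigma_algebraType (@open 'rV[R]_d))
    (measurableTypeR R) A u.

End L2.

(* Functions on the closure of Omega are represented by total functions on
   'rV[R]_d. [basis z] is the Lagrange basis function attached to the mesh
   point [z]; [basis] and [weight] are only used at mesh points. *)
Record nodal_space (R : realType) (d : nat) := NodalSpace {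
  Omega : set 'rV[R]_d;
  Omega_open : open Omega;
  Omega_connected : connected Omega;
  Omega_nonempty : Omega !=set0;
  Omega_bounded : bounded_set Omega;
  mesh : seq 'rV[R]_d;
  mesh_uniq : uniq mesh;
  mesh_closure : forall z, z \in mesh -> closure Omega z;
  basis : 'rV[R]_d -> 'rV[R]_d -> R;
  basis_nodal : forall y z, y \in mesh -> z \in mesh ->
    basis y z = (y == z)%:R;
  basis_borel : forall z, z \in mesh -> borel_fun Omega (basis z);
  basis_l2 : forall z, z \in mesh -> (l2sq Omega (basis z) < +oo)%E;
  weight : 'rV[R]_d -> R;
  weight_gt0 : forall z, z \in mesh -> 0 < weight z }.

Section DiscreteSpace.
Variables (R : realType) (d : nat) (S : nodal_space R d).

Definition Xh : set ('rV[R]_d -> R) :=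
  [set u | exists c : 'rV[R]_d -> R,
    forall x, u x = \sum_(z <- mesh S) c z * basis S z x].

Definition ip (u v : 'rV[R]_d -> R) : R :=
  \sum_(z <- mesh S) weight S z * (u z * v z).

Definition vip (p q : 'rV[R]_d -> 'rV[R]_d) : R :=
  \sum_(z <- mesh S) weight S z * edot (p z) (q z).

Definition hnorm (u : 'rV[R]_d -> R) : R := Num.sqrt (ip u u).

Definition vhnorm (p : 'rV[R]_d -> 'rV[R]_d) : R := Num.sqrt (vip p p).

End DiscreteSpace.

(* [grad u z] is the value at the mesh point [z] of the gradient of the discrete
   function [u]. It is the gradient of [u] wherever [u] has one; at mesh points
   where it has none (nodes on interfaces between finite elements) it is the
   nodal value chosen by the discretization, depending linearly on [u].
   [lform] is the bilinear form of the discretized operator. *)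
Record discretization (R : realType) (d : nat) := Discretization {
  space :> nodal_space R d;
  one_in_Xh : Xh space (fun=> 1);
  norm_equiv : exists c c' : R, [/\ 0 < c, 0 < c' &
    forall u, Xh space u ->
      c * l2norm (Omega space) u <= hnorm space u
        <= c' * l2norm (Omega space) u];
  grad : ('rV[R]_d -> R) -> 'rV[R]_d -> 'rV[R]_d;
  grad_gradient : forall u z, Xh space u -> z \in mesh space ->
    (exists p, has_gradient (closure (Omega space)) u z p) ->
    has_gradient (closure (Omega space)) u z (grad u z);
  grad_linear : forall (k : R) u v z, Xh space u -> Xh space v ->
    z \in mesh space ->
    grad (fun x => k * u x + v x) z = k *: grad u z + grad v z;
  lform : ('rV[R]_d -> R) -> ('rV[R]_d -> R) -> R;
  lform_linear_l : forall (k : R) u v w,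
    Xh space u -> Xh space v -> Xh space w ->
    lform (fun x => k * u x + v x) w = k * lform u w + lform v w;
  lform_linear_r : forall (k : R) u v w,
    Xh space u -> Xh space v -> Xh space w ->
    lform w (fun x => k * u x + v x) = k * lform w u + lform w v }.

Section Scheme.
Variable R : realType.

Definition gfun (a b u : R) : R := (b - u) * (u - a).

Definition dgfun (a b u : R) : R := a + b - 2 * u.

Definition extrap (d : nat) (u : nat -> 'rV[R]_d -> R) (n : nat)
    (z : 'rV[R]_d) : R :=
  if n is n'.+1 then 2 * u n'.+1 z - u n' z else u 0%N z.

End Scheme.

(* Main.v *)
Require Import Defs.
From mathcomp Require Import all_boot all_order all_algebra.
From mathcomp Require Import all_classical all_reals all_analysis.
From mathcomp Require Import ring lra.

Set Implicit Arguments.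
Unset Strict Implicit.
Unset Printing Implicit Defensive.

Import Order.TTheory GRing.Theory Num.Theory.
Import numFieldNormedType.Exports.
Local Open Scope classical_set_scope.
Local Open Scope ring_scope.

(** The stability bound rests on treating the total multiplier
mu^n = lambda^n g'(u^n) + xi^n as minus an element of the normal cone, at u^n,
of the convex set of nodal functions with values in [a, b] and with the mass
of u^n. Conservation gives (mu^n, 1) = 0: adding the two substeps and testing
with 1 leaves the difference quotient of a conserved mass. Complementarity
then gives (mu^n, v - u^n) >= 0 for every v of that set
([multiplier_variational]), and comparing with the constant mean of u^n gives
(mu^n, u^n) <= 0 ([multiplier_pairing_le0]).

Put E_n = |u^n|^2 + |2 u^n - u^(n-1)|^2 + (4/3) dt^2 |mu^n|^2. With U = u^(n+1),
b = u^n, c = u^(n-1), w = 2 b - c, x = dt (mu^(n+1) - mu^n) and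
ut = U - (2/3) x the value before projection, the nodal identity

  2 (3 ut - 4 b + c) ut - 4 dt mu^n ut
    = E_(n+1) - E_n + (ut - w)^2 + (8/9) x^2
      - (8/3) x (U - b) - 4 dt mu^(n+1) U

turns the scheme tested with ut into an energy balance. By the variational
inequality at the times n and n+1, the sum of the last two terms over the mesh is
nonnegative. The square (ut - w)^2 is what removes any restriction on the time
step: the reaction term f1(w) ut is f1(w) w + f1(w) (ut - w), where the first
part is bounded by the old energy and the second is absorbed by the square at
the cost of dt^2 |f1(w)|^2. Hence E_(n+1) + 2 dt C0 |grad ut|^2 <= (1 + A dt) E_n,
with A depending on T, C0 and growth constants of f1, f2 only
([bdf2_energy_step]). The starting step is similar ([euler_energy_step]), and a
discrete Gronwall inequality bounds E_m plus the dissipation by a multiple of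
|u^0|^2; four times this controls the left-hand side.

The extrapolation w may leave [a, b], but it stays in a fixed bounded interval,
where a locally Lipschitz function vanishing at 0 grows at most linearly
([locally_lipschitz_linear_growth]). *)

(** * Euclidean inequalities and linear growth *)

Lemma edot_ge0 (R : realType) (d : nat) (p : 'rV[R]_d) : 0 <= edot p p.
Proof. by apply: sumr_ge0 => i _; rewrite -expr2 sqr_ge0. Qed.

(** Young's inequality with the weight that splits the gradient term off the
convective term and lets half of the coercivity constant absorb it. *)
Lemma edot_young (R : realType) (d : nat) (k : R) (p q : 'rV[R]_d) :
  0 < k -> 2 * edot p q <= k * edot q q + k^-1 * edot p p.
Proof.
move=> k0; rewrite /edot !mulr_sumr -big_split /=; apply: ler_sum => i _.
have -> : k * (q ord0 i * q ord0 i) + k^-1 * (p ord0 i * p ord0 i)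
   = 2 * (p ord0 i * q ord0 i) + k * (q ord0 i - k^-1 * p ord0 i) ^+ 2.
  by field; rewrite gt_eqF.
by rewrite lerDl mulr_ge0 ?sqr_ge0 ?ltW.
Qed.

Lemma edot_le_norm (R : realType) (d : nat) (p : 'rV[R]_d) :
  edot p p <= d%:R * `|p| ^+ 2.
Proof.
rewrite -[d in d%:R]card_ord -sum1_card natr_sum mulr_suml /edot.
apply: ler_sum => i _; rewrite mul1r -expr2 -[leLHS]real_normK ?num_real// ler_sqr ?nnegrE//.
by rewrite [leRHS]/Num.norm /= mx_normrE (le_bigmax _ _ (ord0, i)).
Qed.

(** Local Lipschitz continuity at the pair (x, 0), compared with F 0 = 0, gives
the linear bound near x with a constant depending on x; compactness of [-M, M]
makes the constant uniform. *)
Lemma locally_lipschitz_linear_growth (R : realType) (W : normedModType R)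
    (F : R -> W) (M : R) :
  [locally [lipschitz F x | x in [set: R]]] -> F 0 = 0 ->
  exists2 K : R, 0 < K & forall s, `|s| <= M -> `|F s| <= K * `|s|.
Proof.
move=> Flip F0.
have /compact_near_coveringP cov : compact (`[- M, M] : set R).
  exact: segment_compact.
have := cov R +oo (fun K s => `|F s| <= K * `|s|) _ _.
case => [x _|K0 [_ H]].
  have /pinfty_ex_gt0[k k0] := Flip (x, 0) (conj I I).
  rewrite /within /= => -[[A B]] /= [nA nB] AB.
  exists (A, [set i | k <= i]) => /=.
    by split => //; apply: nbhs_pinfty_ge; rewrite num_real.
  move=> [s i] /= [As ki].
  have /= := AB (s, 0) (conj As (nbhs_singleton nB)) (conj I I).
  by rewrite F0 !subr0 => /le_trans; apply; rewrite ler_wpM2r.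
exists (`|K0| + 1); first by rewrite ltr_wpDl.
move=> s sM; apply: H; last by rewrite /= in_itv /= -ler_norml.
by rewrite (le_lt_trans (ler_norm _))// ltrDl.
Qed.

(** * The discrete inner product as a quadrature *)

Section Quadrature.
Variables (R : realType) (d : nat) (D : nodal_space R d).
Implicit Types (F G : 'rV[R]_d -> R).

(** Both discrete inner products are, by conversion, values of this functional,
so that nodal inequalities integrate to inequalities between them. *)
Definition quad F : R := \sum_(z <- mesh D) weight D z * F z.

Lemma quadD F G : quad (fun z => F z + G z) = quad F + quad G.
Proof. by rewrite -big_split; apply: eq_bigr => z _; rewrite mulrDr. Qed.

Lemma quadZ k F : quad (fun z => k * F z) = k * quad F.
Proof. by rewrite /quad mulr_sumr; apply: eq_bigr => z _; rewrite mulrCA. Qed.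

Lemma quadN F : quad (fun z => - F z) = - quad F.
Proof. by rewrite /quad -sumrN; apply: eq_bigr => z _; rewrite mulrN. Qed.

Lemma eq_quad F G : {in mesh D, F =1 G} -> quad F = quad G.
Proof. by move=> FG; apply: eq_big_seq => z zD; rewrite FG. Qed.

Lemma le_quad F G : (forall z, z \in mesh D -> F z <= G z) -> quad F <= quad G.
Proof.
move=> FG; rewrite /quad big_seq [leRHS]big_seq.
by apply: ler_sum => z zD; rewrite ler_wpM2l ?FG// ltW ?weight_gt0.
Qed.

Lemma quad_ge0 F : (forall z, z \in mesh D -> 0 <= F z) -> 0 <= quad F.
Proof.
move=> F0; rewrite /quad big_seq; apply: sumr_ge0 => z zD.
by rewrite mulr_ge0 ?F0// ltW ?weight_gt0.
Qed.

Lemma quad_cst c : quad (fun=> c) = c * quad (fun=> 1).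
Proof. by rewrite -quadZ; apply: eq_quad => z _; rewrite mulr1. Qed.

(** The bounds on the mean are stated at the mesh points since there is no mean
to speak of on an empty mesh. *)
Lemma quad_mean a b F : (forall z, z \in mesh D -> a <= F z <= b) ->
  exists2 c, quad F = quad (fun=> c) & forall z, z \in mesh D -> a <= c <= b.
Proof.
move=> Fab; have [m0|m_neq0] := eqVneq (mesh D) [::].
  by exists 0; rewrite ?m0// /quad m0 !big_nil.
have W0 : 0 < quad (fun=> 1).
  rewrite /quad; case: (mesh D) m_neq0 (@weight_gt0 _ _ D) => // z s _ wgt0.
  rewrite big_cons ltr_pwDl ?mulr1 ?wgt0 ?mem_head// big_seq sumr_ge0// => y ys.
  by rewrite mulr1 ltW// wgt0// in_cons ys orbT.
exists (quad F / quad (fun=> 1)); first by rewrite quad_cst divfK ?gt_eqF.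
move=> _ _; rewrite ler_pdivlMr// ler_pdivrMr// -!quad_cst.
by rewrite !le_quad// => z /Fab/andP[].
Qed.

Lemma ip_ge0 (u : 'rV[R]_d -> R) : 0 <= ip D u u.
Proof. by apply: quad_ge0 => z _; rewrite -expr2 sqr_ge0. Qed.

Lemma vip_ge0 (p : 'rV[R]_d -> 'rV[R]_d) : 0 <= vip D p p.
Proof. by apply: quad_ge0 => z _; exact: edot_ge0. Qed.

Lemma hnorm_sqr (u : 'rV[R]_d -> R) : hnorm D u ^+ 2 = ip D u u.
Proof. by rewrite sqr_sqrtr ?ip_ge0. Qed.

Lemma vhnorm_sqr (p : 'rV[R]_d -> 'rV[R]_d) : vhnorm D p ^+ 2 = vip D p p.
Proof. by rewrite sqr_sqrtr ?vip_ge0. Qed.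

End Quadrature.

(** * The multiplier as a normal vector *)

Section Multiplier.
Variables (R : realType) (d : nat) (D : nodal_space R d) (a b : R).
Hypothesis ab : a < b.
Implicit Types (U v lam : 'rV[R]_d -> R).

Lemma gfun_ge0 x : 0 <= gfun a b x -> a <= x <= b.
Proof.
move=> g0; apply/andP; split; rewrite leNgt; apply/negP => h;
  move: g0; rewrite /gfun leNgt => /negP; apply.
  by rewrite pmulr_rlt0 ?subr_lt0// subr_gt0 (lt_trans h).
by rewrite pmulr_llt0 ?subr_lt0// subr_gt0 (lt_trans ab).
Qed.

(** A nonzero multiplier occurs only where x is a or b, and there the sign of g'
points into the interval. *)
Lemma complementarity_variational l x y :
  0 <= l -> 0 <= gfun a b x -> l * gfun a b x = 0 -> a <= y <= b ->
  0 <= l * dgfun a b x * (y - x).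
Proof.
move=> l0 /gfun_ge0/andP[ax xb] /eqP; rewrite /gfun /dgfun !mulf_eq0 !subr_eq0.
move=> /orP[/eqP->|/orP[/eqP xE|/eqP xE]] /andP[ay yb].
- by rewrite !mul0r.
- by rewrite -xE -mulrA mulr_ge0// mulr_le0// ?subr_le0//; lra.
- by rewrite xE -mulrA mulr_ge0// mulr_ge0// ?subr_ge0//; lra.
Qed.

Definition admissible_multiplier U lam := forall z, z \in mesh D ->
  [/\ 0 <= lam z, 0 <= gfun a b (U z) & lam z * gfun a b (U z) = 0].

(** The constant xi drops out because v and U have the same mass. *)
Lemma multiplier_variational U lam xi v : admissible_multiplier U lam ->
  (forall z, z \in mesh D -> a <= v z <= b) -> ip D v (fun=> 1) = ip D U (fun=> 1) ->
  0 <= ip D (fun z => lam z * dgfun a b (U z) + xi) (fun z => v z - U z).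
Proof.
move=> lamU vab mass.
have -> : ip D (fun z => lam z * dgfun a b (U z) + xi) (fun z => v z - U z)
  = quad D (fun z => lam z * dgfun a b (U z) * (v z - U z))
    + xi * (ip D v (fun=> 1) + -1 * ip D U (fun=> 1)).
  rewrite -[ip D v _]/(quad D (fun z => v z * 1)).
  rewrite -[ip D U _]/(quad D (fun z => U z * 1)) -quadZ -quadD -quadZ -quadD.
  by apply: eq_quad => z _; ring.
rewrite mass mulN1r subrr mulr0 addr0; apply: quad_ge0 => z zD.
by have [l0 g0 lg] := lamU z zD; apply: complementarity_variational => //; exact: vab.
Qed.

(** The competitor is the constant equal to the mean of U, which is orthogonal
to the multiplier. *)
Lemma multiplier_pairing_le0 U lam xi : admissible_multiplier U lam ->
  ip D (fun z => lam z * dgfun a b (U z) + xi) (fun=> 1) = 0 ->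
  ip D (fun z => lam z * dgfun a b (U z) + xi) U <= 0.
Proof.
set mu := fun z => _ => lamU mu1.
have [|c Uc cab] := @quad_mean _ _ D a b U.
  by move=> z zD; have [_ /gfun_ge0] := lamU z zD.
have := @multiplier_variational U lam xi (fun=> c) lamU cab.
rewrite -/mu (_ : ip D mu _ = c * ip D mu (fun=> 1) + -1 * ip D mu U); last first.
  rewrite -[ip D mu U]/(quad D (fun z => mu z * U z)).
  rewrite -[ip D mu _ in RHS]/(quad D (fun z => mu z * 1)) -!quadZ -quadD.
  by apply: eq_quad => z _; ring.
rewrite mu1 mulr0 add0r mulN1r oppr_ge0; apply.
transitivity (quad D (fun=> c)); first by apply: eq_quad => z _; rewrite mulr1.
by rewrite -Uc; apply: eq_quad => z _; rewrite mulr1.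
Qed.

End Multiplier.

(** * Nodal energy inequalities *)

Section Nodal.
Variable R : realType.

(** At a mesh point, P, Q and F2 stand for |p|^2, F . p and |F|^2, where p is the
gradient of ut and F is f2 at the extrapolated value. On the right, the bracket
sums to at most zero by the scheme and coercivity, and the three multiplier
terms by the variational inequalities. *)
Lemma bdf2_nodal (T C0 K L dt b c U ut m m' f Q P F2 : R) :
  0 < C0 -> 0 <= K -> 0 < dt -> dt <= T ->
  3 * (U - ut) / (2 * dt) = m' - m ->
  `|f| <= K * `|2 * b - c| -> F2 <= L * (2 * b - c) ^+ 2 ->
  2 * Q <= C0 * P + C0^-1 * F2 -> 0 <= L ->
  U * U + (2 * U - b) * (2 * U - b) + 4 / 3 * dt ^+ 2 * (m' * m')
   + 2 * dt * (C0 * P)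
  <= (1 + (4 * K + 4 * K ^+ 2 * T + 2 * C0^-1 * L) * dt)
       * (b * b + (2 * b - c) * (2 * b - c) + 4 / 3 * dt ^+ 2 * (m * m))
     + 4 * dt * ((3 * ut - 4 * b + c) / (2 * dt) * ut + C0 * P + f * ut - Q - m * ut)
     + 4 * dt * (m' * U) - 8 / 3 * dt * (m' * (b - U)) - 8 / 3 * dt * (m * (U - b)).
Proof.
move=> C0_gt0 K0 dt0 dtT mE fle F2le Qle L0.
have {mE} utE : ut = U - 2 / 3 * (dt * (m' - m)).
  by rewrite -mE; field; rewrite gt_eqF.
set w := 2 * b - c in fle F2le *; set y := ut - w.
set E := b * b + _ + _.
have f2 : f ^+ 2 <= K ^+ 2 * w ^+ 2.
  rewrite -[leLHS]real_normK ?num_real// -[w ^+ 2]real_normK ?num_real// -exprMn.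
  by rewrite ler_sqr ?nnegrE ?mulr_ge0.
have fw : - (K * w ^+ 2) <= f * w.
  apply: le_trans (lerNnormlW (lexx `|f * w|)).
  by rewrite lerN2 normrM -(real_normK (num_real w)) expr2 mulrA ler_wpM2r.
have wE : w ^+ 2 <= E.
  have -> : E = w ^+ 2 + (b ^+ 2 + (dt * m) ^+ 2 *+ 4 / 3) by rewrite /E; field.
  by rewrite lerDl addr_ge0 ?sqr_ge0// divr_ge0 ?mulrn_wge0 ?sqr_ge0.
have dt_f2 : dt * f ^+ 2 <= T * (K ^+ 2 * w ^+ 2).
  by rewrite ler_pM ?sqr_ge0 ?(ltW dt0).
have A0 : 0 <= 4 * K + 4 * K ^+ 2 * T + 2 * C0^-1 * L.
  have T0 : 0 <= T := ltW (lt_le_trans dt0 dtT).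
  by rewrite !addr_ge0 ?mulr_ge0 ?sqr_ge0 ?invr_ge0// ltW.
have AE := ler_wpM2l A0 wE.
have F2L : C0^-1 * F2 <= C0^-1 * (L * w ^+ 2) by rewrite ler_pM2l ?invr_gt0.
(* The slack is the completed square that absorbs the reaction term, plus
   dt times a quantity bounded below by the growth of f and F. *)
rewrite -subr_ge0 [leRHS](_ : _ = dt * ((4 * K + 4 * K ^+ 2 * T + 2 * C0^-1 * L) * E
    - 4 * (dt * f ^+ 2) + 4 * (f * w) + 2 * (C0 * P) - 4 * Q)
    + 8 / 9 * (dt * (m' - m)) ^+ 2 + (y + 2 * dt * f) ^+ 2); last first.
  by rewrite /E /y /w utE; field; rewrite !gt_eqF.
apply: addr_ge0 (sqr_ge0 _); apply: addr_ge0; last by rewrite mulr_ge0 ?sqr_ge0// divr_ge0.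
by rewrite mulr_ge0 ?(ltW dt0)//; lra.
Qed.

(** Same roles as in [bdf2_nodal]. The factor 9 comes from
U^2 + (2 U - u0)^2 <= 9 U^2 + 2 u0^2. *)
Lemma euler_nodal (T C0 K L dt u0 U ut m f Q P F2 : R) :
  0 < C0 -> 0 <= K -> 0 <= L -> 0 <= P -> 0 < dt -> dt <= T ->
  (U - ut) / dt = m ->
  `|f| <= K * `|u0| -> F2 <= L * u0 ^+ 2 ->
  2 * Q <= C0 * P + C0^-1 * F2 ->
  U * U + (2 * U - u0) * (2 * U - u0) + 4 / 3 * dt ^+ 2 * (m * m)
   + 2 * dt * (C0 * P)
  <= (11 + 9 * (2 * K * T + K ^+ 2 * T ^+ 2 + C0^-1 * L * T)) * (u0 * u0)
     + 18 * dt * ((ut - u0) / dt * ut + C0 * P + f * ut - Q)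
     + 18 * dt * (m * U).
Proof.
move=> C0_gt0 K0 L0 P0 dt0 dtT mE fle F2le Qle.
have {mE} UE : U = ut + dt * m by rewrite -mE; field; rewrite gt_eqF.
have T0 : 0 <= T := ltW (lt_le_trans dt0 dtT).
have Ku0 : 0 <= K * u0 ^+ 2 by rewrite mulr_ge0 ?sqr_ge0.
have fu : - (K * u0 ^+ 2) <= f * u0.
  apply: le_trans (lerNnormlW (lexx `|f * u0|)).
  by rewrite lerN2 normrM -(real_normK (num_real u0)) expr2 mulrA ler_wpM2r.
have f2 : (dt * f) ^+ 2 <= (T * (K * `|u0|)) ^+ 2.
  rewrite -[leLHS]real_normK ?num_real// ler_sqr ?nnegrE ?mulr_ge0//.
  by rewrite normrM gtr0_norm// ler_pM// ltW.
have {}f2 : (dt * f) ^+ 2 <= K ^+ 2 * T ^+ 2 * u0 ^+ 2.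
  by apply: le_trans f2 _; rewrite !exprMn mulrA [T ^+ 2 * _]mulrC real_normK ?num_real.
have F2L : C0^-1 * F2 <= C0^-1 * (L * u0 ^+ 2) by rewrite ler_pM2l ?invr_gt0.
have KT : dt * (K * u0 ^+ 2) <= T * (K * u0 ^+ 2) by rewrite ler_wpM2r.
have LT : dt * (C0^-1 * (L * u0 ^+ 2)) <= T * (C0^-1 * (L * u0 ^+ 2)).
  by rewrite ler_wpM2r// mulr_ge0 ?invr_ge0 ?(ltW C0_gt0)// mulr_ge0 ?sqr_ge0.
have dtfu : 0 <= dt * (f * u0 + K * u0 ^+ 2) by rewrite mulr_ge0 ?(ltW dt0)//; lra.
have CP : 0 <= C0 * P by rewrite mulr_ge0// ltW.
have dtQ : 0 <= dt * (9 * (C0^-1 * (L * u0 ^+ 2)) + 16 * (C0 * P) - 18 * Q).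
  by rewrite mulr_ge0 ?(ltW dt0)//; lra.
rewrite -subr_ge0 [leRHS](_ : _ =
    9 * (2 * K * T + K ^+ 2 * T ^+ 2 + C0^-1 * L * T) * u0 ^+ 2
    + (2 * U + u0) ^+ 2 + 23 / 3 * (dt * m) ^+ 2 + 9 * (ut - u0 + dt * f) ^+ 2
    - 9 * (dt * f) ^+ 2 + 18 * (dt * (f * u0)) + 16 * dt * (C0 * P)
    - 18 * dt * Q); last first.
  by rewrite UE; field; rewrite !gt_eqF.
have := sqr_ge0 (2 * U + u0); have := sqr_ge0 (dt * m).
have := sqr_ge0 (ut - u0 + dt * f).
lra.
Qed.

End Nodal.

(** * A discrete Gronwall inequality *)

(** The amplification factor can also be applied to the accumulated s, because
it is at least 1. *)
Lemma discrete_gronwall (R : realType) (q : R) (e s : nat -> R) : 0 <= q ->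
  (forall n, 0 <= e n) -> (forall n, 0 <= s n) ->
  (forall n, e n.+1 + s n.+1 <= (1 + q) * e n) ->
  forall n, e n + \sum_(0 <= k < n.+1) s k <= (1 + q) ^+ n * (e 0%N + s 0%N).
Proof.
move=> q0 e0 s0 es; elim=> [|n IHn]; first by rewrite big_nat1 mul1r.
rewrite big_nat_recr//= exprS -mulrA.
apply: le_trans (ler_wpM2l _ IHn); last exact: addr_ge0.
have S0 : 0 <= q * \sum_(0 <= k < n.+1) s k by rewrite mulr_ge0 ?sumr_ge0.
have := es n; lra.
Qed.

(** * Energy estimates for one time step *)

Section EnergySteps.
Variables (R : realType) (d : nat) (D : nodal_space R d) (T C0 K L dt : R).
Hypotheses (C0_gt0 : 0 < C0) (K_ge0 : 0 <= K) (L_ge0 : 0 <= L).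
Hypotheses (dt_gt0 : 0 < dt) (dt_le : dt <= T).

Definition energy (u u_old mu : 'rV[R]_d -> R) : R :=
  ip D u u + ip D (fun z => 2 * u z - u_old z) (fun z => 2 * u z - u_old z)
  + 4 / 3 * dt ^+ 2 * ip D mu mu.

Definition growth_rate : R := 4 * K + 4 * K ^+ 2 * T + 2 * C0^-1 * L.

Definition start_factor : R :=
  11 + 9 * (2 * K * T + K ^+ 2 * T ^+ 2 + C0^-1 * L * T).

(** Testing with ut leaves only numbers and nodal values, so the discrete space
is not mentioned: l is the value of the bilinear form at (ut, ut), p the
gradient of ut, f and F the nonlinear terms at the extrapolated values, m and
m' the total multipliers at the old and new times. *)
Lemma bdf2_energy_step (c b ut U m m' f : 'rV[R]_d -> R)
    (F p : 'rV[R]_d -> 'rV[R]_d) (l : R) :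
  (forall z, z \in mesh D -> 3 * (U z - ut z) / (2 * dt) = m' z - m z) ->
  (forall z, z \in mesh D -> `|f z| <= K * `|2 * b z - c z|) ->
  (forall z, z \in mesh D -> edot (F z) (F z) <= L * (2 * b z - c z) ^+ 2) ->
  C0 * vip D p p <= l ->
  ip D (fun z => (3 * ut z - 4 * b z + c z) / (2 * dt)) ut + l + ip D f ut
    - vip D F p = ip D m ut ->
  ip D m' U <= 0 -> 0 <= ip D m' (fun z => b z - U z) ->
  0 <= ip D m (fun z => U z - b z) ->
  energy U b m' + 2 * dt * (C0 * vip D p p) <= (1 + growth_rate * dt) * energy b c m.
Proof.
move=> rel fle Fle coer scheme mU mb mU'.
have := le_quad (fun z zD => bdf2_nodal C0_gt0 K_ge0 dt_gt0 dt_le (rel z zD)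
  (fle z zD) (Fle z zD) (edot_young (F z) (p z) C0_gt0) L_ge0).
rewrite !(quadD, quadN, quadZ) -/growth_rate.
have coer' : 0 <= dt * (l - C0 * vip D p p) by rewrite mulr_ge0 ?subr_ge0// ltW.
have mU0 : dt * ip D m' U <= 0 by rewrite pmulr_rle0.
have mb0 : 0 <= dt * ip D m' (fun z => b z - U z) by rewrite pmulr_rge0.
have mU'0 : 0 <= dt * ip D m (fun z => U z - b z) by rewrite pmulr_rge0.
have := congr1 ( *%R dt) scheme.
move: coer' mU0 mb0 mU'0; rewrite /energy /ip /vip /quad /=; lra.
Qed.

Lemma euler_energy_step (u0 ut U m f : 'rV[R]_d -> R)
    (F p : 'rV[R]_d -> 'rV[R]_d) (l : R) :
  (forall z, z \in mesh D -> (U z - ut z) / dt = m z) ->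
  (forall z, z \in mesh D -> `|f z| <= K * `|u0 z|) ->
  (forall z, z \in mesh D -> edot (F z) (F z) <= L * u0 z ^+ 2) ->
  C0 * vip D p p <= l ->
  ip D (fun z => (ut z - u0 z) / dt) ut + l + ip D f ut - vip D F p = 0 ->
  ip D m U <= 0 ->
  energy U u0 m + 2 * dt * (C0 * vip D p p) <= start_factor * ip D u0 u0.
Proof.
move=> rel fle Fle coer scheme mU.
have := le_quad (fun z zD => euler_nodal C0_gt0 K_ge0 L_ge0 (edot_ge0 (p z))
  dt_gt0 dt_le (rel z zD) (fle z zD) (Fle z zD) (edot_young (F z) (p z) C0_gt0)).
rewrite !(quadD, quadN, quadZ) -/start_factor.
have coer' : 0 <= dt * (l - C0 * vip D p p) by rewrite mulr_ge0 ?subr_ge0// ltW.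
have mU0 : dt * ip D m U <= 0 by rewrite pmulr_rle0.
have := congr1 ( *%R dt) scheme.
move: coer' mU0; rewrite /energy /ip /vip /quad /=; lra.
Qed.

Lemma energy_ge0 u u_old mu : 0 <= energy u u_old mu.
Proof. by rewrite !addr_ge0 ?ip_ge0// !mulr_ge0 ?ip_ge0 ?invr_ge0 ?ltW. Qed.

End EnergySteps.

(** * The stability theorem *)

Theorem theorem3p1 (R : realType) (d : nat) (a b T C0 C1 C2 : R)
  (f1 : R -> R) (f2 : R -> 'rV[R]_d)
  (ab : a < b) (T_gt0 : 0 < T) (C0_gt0 : 0 < C0)
  (f1_lip : [locally [lipschitz f1 x | x in [set: R]]])
  (f2_lip : [locally [lipschitz f2 x | x in [set: R]]])
  (f1_0 : f1 0 = 0) (f2_0 : f2 0 = 0)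
  (f1_bound : forall s : R, a <= s <= b -> `|f1 s| <= C1 * `|s|)
  (f2_bound : forall s : R, a <= s <= b -> enorm (f2 s) <= C2 * `|s|) :
  exists2 C : R, 0 < C &
  forall (D : discretization R d)
    (coercive : forall v, Xh D v ->
       C0 * vhnorm D (grad D v) ^+ 2 <= lform D v v)
    (dt : R) (dt_gt0 : 0 < dt)
    (u ut lam : nat -> 'rV[R]_d -> R) (xi : nat -> R)
    (u_Xh : forall n, Xh D (u n))
    (ut_Xh : forall n, Xh D (ut n.+1))
    (u0_bounds : forall z, z \in mesh D -> a <= u 0%N z <= b)
    (* second-order scheme, n >= 1 *)
    (step1 : forall n, (1 <= n)%N -> forall v, Xh D v ->
       ip D (fun z => (3 * ut n.+1 z - 4 * u n z + u n.-1 z) / (2 * dt)) v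
       + lform D (ut n.+1) v
       + ip D (fun z => f1 (extrap u n z)) v
       - vip D (fun z => f2 (extrap u n z)) (grad D v)
       = ip D (fun z => lam n z * dgfun a b (u n z) + xi n) v)
    (step2 : forall n, (1 <= n)%N -> forall z, z \in mesh D ->
       [/\ 3 * (u n.+1 z - ut n.+1 z) / (2 * dt)
           = lam n.+1 z * dgfun a b (u n.+1 z) - lam n z * dgfun a b (u n z)
             + xi n.+1 - xi n,
           0 <= lam n.+1 z,
           0 <= gfun a b (u n.+1 z) &
           lam n.+1 z * gfun a b (u n.+1 z) = 0])
    (mass : forall n, (1 <= n)%N ->
       ip D (u n.+1) (fun=> 1) = ip D (u n) (fun=> 1))
    (* first-order start, n = 0 *)
    (start1 : forall v, Xh D v ->
       ip D (fun z => (ut 1%N z - u 0%N z) / dt) v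
       + lform D (ut 1%N) v
       + ip D (fun z => f1 (extrap u 0 z)) v
       - vip D (fun z => f2 (extrap u 0 z)) (grad D v)
       = 0)
    (start2 : forall z, z \in mesh D ->
       [/\ (u 1%N z - ut 1%N z) / dt
           = lam 1%N z * dgfun a b (u 1%N z) + xi 1%N,
           0 <= lam 1%N z,
           0 <= gfun a b (u 1%N z) &
           lam 1%N z * gfun a b (u 1%N z) = 0])
    (start_mass : ip D (u 1%N) (fun=> 1) = ip D (u 0%N) (fun=> 1))
    (* the generic scheme is mass conservative *)
    (conservative : forall n,
       lform D (ut n.+1) (fun=> 1)
       + ip D (fun z => f1 (extrap u n z)) (fun=> 1)
       - vip D (fun z => f2 (extrap u n z)) (grad D (fun=> 1))
       = 0)
    (m : nat) (m_ge1 : (1 <= m)%N) (m_le : m%:R <= T / dt),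
    4 * hnorm D (u m) ^+ 2
    + hnorm D (fun z => 2 * u m z - u m.-1 z) ^+ 2
    + 4 / 3 * dt ^+ 2
      * hnorm D (fun z => lam m z * dgfun a b (u m z) + xi m) ^+ 2
    + 2 * dt * \sum_(0 <= n < m) C0 * vhnorm D (grad D (ut n.+1)) ^+ 2
    <= C * hnorm D (u 0%N) ^+ 2.
Proof.
set M := 3 * (`|a| + `|b|).
have [K K0 f1le] := locally_lipschitz_linear_growth M f1_lip f1_0.
have [K2 K20 f2le] := locally_lipschitz_linear_growth M f2_lip f2_0.
pose L := d%:R * K2 ^+ 2.
have L0 : 0 <= L by rewrite mulr_ge0 ?sqr_ge0.
have K0' := ltW K0.
have f2sq s : `|s| <= M -> edot (f2 s) (f2 s) <= L * s ^+ 2.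
  move=> sM; apply: le_trans (edot_le_norm _) _; rewrite -mulrA ler_wpM2l//.
  rewrite -[s ^+ 2]real_normK ?num_real// -exprMn ler_sqr ?nnegrE ?f2le//.
  by rewrite mulr_ge0// ltW.
set A := growth_rate T C0 K L.
set B := start_factor T C0 K L.
have T0 := ltW T_gt0.
have A0 : 0 <= A.
  by rewrite /A /growth_rate !addr_ge0 ?mulr_ge0 ?sqr_ge0 ?invr_ge0// ltW.
have B0 : 0 < B.
  rewrite /B /start_factor ltr_wpDr// mulr_ge0//.
  by rewrite !addr_ge0 ?mulr_ge0 ?sqr_ge0 ?invr_ge0// ltW.
exists (4 * (expR (A * T) * B)); first by rewrite !mulr_gt0 ?expR_gt0.
move=> D coercive dt dt_gt0 u ut lam xi u_Xh ut_Xh u0_bounds step1 step2 mass.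
move=> start1 start2 start_mass conservative m m_ge1 m_le.
have m_dt : m%:R * dt <= T by rewrite -ler_pdivlMr.
have dt_le : dt <= T.
  by apply: le_trans m_dt; rewrite ler_peMl ?(ltW dt_gt0)// ler1n.
pose mu n z := lam n z * dgfun a b (u n z) + xi n.
have adm n : admissible_multiplier D a b (u n.+1) (lam n.+1).
  move=> z zD; case: n => [|n]; first by have [] := start2 z zD.
  by have [] := step2 n.+1 isT z zD.
have u_bounds n z : z \in mesh D -> a <= u n z <= b.
  case: n => [|n] zD; first exact: u0_bounds.
  by have [_ + _] := adm n z zD; exact: gfun_ge0.
have u_mass n : ip D (u n.+1) (fun=> 1) = ip D (u n) (fun=> 1).
  by case: n => [|n]; [exact: start_mass|exact: mass].
(* The extrapolation 2 x - y of values of [a, b] can leave [a, b]; the factor 3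
   in M accounts for this. *)
have w_bound n z : z \in mesh D -> `|extrap u n z| <= M.
  move=> zD; have := (lerNnormlW (lexx `|a|), normr_ge0 a).
  have := (ler_norm b, normr_ge0 b).
  rewrite ler_norml /M => -[? ?] [? ?]; case: n => [|n] /=.
    by have /andP[? ?] := u_bounds 0 z zD; apply/andP; split; lra.
  have /andP[? ?] := u_bounds n z zD; have /andP[? ?] := u_bounds n.+1 z zD.
  by apply/andP; split; lra.
(* The scheme tested with 1, together with its conservation law, links the
   mass of ut to the multiplier; the projection step then closes the balance. *)
have mu_mean0 n : ip D (mu n.+1) (fun=> 1) = 0.
  case: n => [|n].
    have := start1 _ (one_in_Xh D); have := conservative 0.
    have -> : ip D (mu 1%N) (fun=> 1) = dt^-1 * (ip D (u 1%N) (fun=> 1)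
        + -1 * ip D (u 0%N) (fun=> 1)) - ip D (fun z => (ut 1%N z - u 0%N z) / dt) (fun=> 1).
      rewrite -!(quadZ D, quadD D, quadN D); apply: eq_quad => z zD.
      by have [mE _ _ _] := start2 z zD; rewrite /mu -mE; ring.
    by rewrite start_mass; lra.
  have := step1 n.+1 isT _ (one_in_Xh D); have := conservative n.+1.
  have -> : ip D (mu n.+2) (fun=> 1) =
      (2 * dt)^-1 * (3 * ip D (u n.+2) (fun=> 1)
                     + -4 * ip D (u n.+1) (fun=> 1) + ip D (u n) (fun=> 1))
      - ip D (fun z => (3 * ut n.+2 z - 4 * u n.+1 z + u n z) / (2 * dt)) (fun=> 1)
      + ip D (mu n.+1) (fun=> 1).
    rewrite -!(quadZ D, quadD D, quadN D); apply: eq_quad => z zD.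
    have [mE _ _ _] := step2 n.+1 isT z zD.
    have -> : mu n.+2 z = 3 * (u n.+2 z - ut n.+2 z) / (2 * dt) + mu n.+1 z.
      by rewrite mE /mu; ring.
    by field; rewrite gt_eqF.
  by rewrite !u_mass /=; rewrite -/(mu n.+1); lra.
have mu_u n : ip D (mu n.+1) (u n.+1) <= 0.
  exact: (multiplier_pairing_le0 ab (adm n) (mu_mean0 n)).
have mu_var n v :=
  @multiplier_variational _ _ D a b ab (u n.+1) (lam n.+1) (xi n.+1) v (adm n).
pose e n := energy D dt (u n.+1) (u n) (mu n.+1).
pose s n := 2 * dt * (C0 * vip D (grad D (ut n.+1)) (grad D (ut n.+1))).
have es n : e n.+1 + s n.+1 <= (1 + A * dt) * e n.
  apply: (bdf2_energy_step C0_gt0 K0' L0 dt_gt0 dt_le (f := fun z => f1 (extrap u n.+1 z))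
    (F := fun z => f2 (extrap u n.+1 z)) (ut := ut n.+2)
    (l := lform D (ut n.+2) (ut n.+2))) => //=.
  - by move=> z zD; have [-> _ _ _] := step2 n.+1 isT z zD; rewrite /mu; ring.
  - by move=> z zD; apply: f1le; exact: (w_bound n.+1).
  - by move=> z zD; apply: f2sq; exact: (w_bound n.+1).
  - by rewrite -vhnorm_sqr; exact: coercive.
  - exact: (step1 n.+1 isT).
  - by apply: mu_var => //; exact: u_bounds.
  - by apply: mu_var => //; exact: u_bounds.
have es0 : e 0%N + s 0%N <= B * ip D (u 0%N) (u 0%N).
  apply: (euler_energy_step C0_gt0 K0' L0 dt_gt0 dt_le (f := fun z => f1 (extrap u 0 z))
    (F := fun z => f2 (extrap u 0 z)) (ut := ut 1%N)
    (l := lform D (ut 1%N) (ut 1%N))) => //=.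
  - by move=> z zD; have [-> _ _ _] := start2 z zD.
  - by move=> z zD; apply: f1le; exact: (w_bound 0%N).
  - by move=> z zD; apply: f2sq; exact: (w_bound 0%N).
  - by rewrite -vhnorm_sqr; exact: coercive.
  - exact: start1.
have e0 n : 0 <= e n by exact: energy_ge0.
have s0 n : 0 <= s n by rewrite !mulr_ge0 ?vip_ge0// ltW.
case: m m_ge1 m_le m_dt => // m _ _ m_dt.
have gron := discrete_gronwall (mulr_ge0 A0 (ltW dt_gt0)) e0 s0 es m.
have Adt1 : 0 <= 1 + A * dt by rewrite addr_ge0 ?mulr_ge0 ?(ltW dt_gt0).
have growth : (1 + A * dt) ^+ m <= expR (A * T).
  apply: (@le_trans _ _ (expR (A * dt) ^+ m)).
    by rewrite lerXn2r ?nnegrE ?expR_ge0 ?expR_ge1Dx.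
  rewrite -expRM_natr ler_expR -mulrA ler_wpM2l// mulrC.
  by apply: le_trans m_dt; rewrite ler_wpM2r ?(ltW dt_gt0)// ler_nat.
have {}gron : e m + \sum_(0 <= k < m.+1) s k
    <= expR (A * T) * (B * ip D (u 0%N) (u 0%N)).
  by apply: le_trans gron _; rewrite ler_pM ?exprn_ge0// addr_ge0.
have sumE : 2 * dt * \sum_(0 <= n < m.+1) C0 * vhnorm D (grad D (ut n.+1)) ^+ 2
    = \sum_(0 <= k < m.+1) s k.
  by rewrite mulr_sumr; apply: eq_bigr => k _; rewrite vhnorm_sqr.
have S0 : 0 <= \sum_(0 <= k < m.+1) s k by rewrite sumr_ge0.
have w2 := ip_ge0 D (fun z => 2 * u m.+1 z - u m z).
have mu2 : 0 <= dt ^+ 2 * ip D (mu m.+1) (mu m.+1) by rewrite mulr_ge0 ?sqr_ge0 ?ip_ge0.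
rewrite sumE !hnorm_sqr /= -/(mu m.+1).
move: gron; rewrite /e /energy; lra.
Qed.
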